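(* Let $K$ be a group, let $(PQR): P\xrightarrow{\bar\jmath}Q\xrightarrow{\bar\phi}R$ be a group extension, let $\theta:Q\to\mathrm{Out}(K)$ be an outer action, and let $(KNP): K\xrightarrow{i_0}N\xrightarrow{\pi_0}P$ be a group extension. Let $(G,j,\pi)$ be an iterated extension of $(KNP)$ by $(PQR)$ whose $Q$-main extension $(G,i,\pi)$ has outer action $\theta$, and let $\Theta$ be its mod-$K$ outer action. Let $(G',j',\pi')$ be any iterated extension of $(KNP)$ by $(PQR)$ with the same mod-$K$ outer action $\Theta$, and let $(G',i',\pi')$ be its $Q$-main extension. Put $$[d]:=\frac{(G',j',\pi')}{(G,j,\pi)}\in H^2(R,Z(K)^P),\qquad [e]:=\frac{(G',i',\pi')}{(G,i,\pi)}\in H^2_P(Q,Z(K)).$$ Then the inflation homomorphism $\mathrm{infl}:H^2(R,Z(K)^P)\to H^2_P(Q,Z(K))$ maps $[d]$ to $[e]$. In other words, via the bijections $-\boxtimes G$, inflation corresponds to the map sending the isomorphism class of an iterated extension $(G',j',\pi')$ of $(KNP)$ by $(PQR)$ with mod-$K$ outer action $\Theta$ to the isomorphism class of its $Q$-main extension $(G',i',\pi')$, among extensions of $K$ by $Q$ with outer action $\theta$ whose $P$-subextension is isomorphic to $(N,i_0,\pi_0)$.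
   Context: Conventions. For a group $H$ and an $H$-module $A$ (multiplicative), cochains are normalized (trivial value whenever an argument is the identity); $Z^2(H,A)$ is the group of normalized maps $d:H\times H\to A$ with $d(h_1,h_2)d(h_1h_2,h_3)={}^{h_1}d(h_2,h_3)d(h_1,h_2h_3)$, $B^2(H,A)$ consists of the maps $\partial z(h_1,h_2)=z(h_1)\cdot{}^{h_1}z(h_2)\cdot z(h_1h_2)^{-1}$ with $z:H\to A$, $z(1)=1$, and $H^2=Z^2/B^2$. Extensions. An extension of $K$ by $Q$ is $(G,i,\pi)$ with $i:K\to G$ injective and $\pi:G\to Q$ surjective homomorphisms, $i(K)=\mathrm{Ker}(\pi)$; groups are identified with their images under the given injections. An isomorphism of extensions is a group isomorphism $\varphi:G_1\to G_2$ with $\varphi\circ i_1=i_2$, $\pi_2\circ\varphi=\pi_1$. Conjugation induces the outer action $Q\to\mathrm{Out}(K)=\mathrm{Aut}(K)/\mathrm{Inn}(K)$. The $P$-subextension of $(G,i,\pi)$ is the extension of $K$ by $P$ given by $\pi^{-1}(P)$ with the induced maps. $Q$ acts on $Z(K)$ via $\theta$, and $R$ acts on $Z(K)^P$ by ${}^{\theta_0(r)}z={}^{\theta(q)}z$ for any $q$ with $\bar\phi(q)=r$. $H^2_P(Q,Z(K)):=\mathrm{Ker}(\mathrm{res}:H^2(Q,Z(K))\to H^2(P,Z(K)))$. Inflation sends $[d]$ to the class of $(q_1,q_2)\mapsto d(\bar\phi(q_1),\bar\phi(q_2))\in Z(K)^P\subseteq Z(K)$. Iterated extensions. An iterated extension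 of $(KNP)$ by $(PQR)$ is $(G,j,\pi)$ with $j:N\to G$ an injective and $\pi:G\to Q$ a surjective homomorphism such that, with $i:=j\circ i_0$ and $\phi:=\bar\phi\circ\pi$, $\pi\circ j=\bar\jmath\circ\pi_0$, $j(N)=\mathrm{Ker}(\phi)$ and $i(K)=\mathrm{Ker}(\pi)$. Its $Q$-main extension is $(G,i,\pi)$. An isomorphism of iterated extensions is a group isomorphism $\varphi:G_1\to G_2$ with $\varphi\circ j_1=j_2$, $\pi_2\circ\varphi=\pi_1$. $\mathrm{Aut}_K(N)$ is the group of automorphisms of $N$ mapping $K$ onto $K$; $\mathrm{Out}(N;K):=\mathrm{Aut}_K(N)/\complement_N(K)$, with $\complement_N(K)$ the inner automorphisms of $N$ by elements of $K$. The mod-$K$ outer action of $(G,j,\pi)$ is the homomorphism $Q\to\mathrm{Out}(N;K)$ sending $\pi(g)$ to the class of conjugation by $g$ on $N$ (via $j$). Classes. For $d\in Z^2(R,Z(K)^P)$, $d\boxtimes G$ is the set $G$ with multiplication $(g_1,g_2)\mapsto d(\phi(g_1),\phi(g_2))\cdot g_1\cdot g_2$; $[d]\mapsto(d\boxtimes G,j,\pi)$ is a bijection $-\boxtimes G$ from $H^2(R,Z(K)^P)$ to isomorphism classes of iterated extensions of $(KNP)$ by $(PQR)$ with mod-$K$ outer action $\Theta$, and $\frac{(G',j',\pi')}{(G,j,\pi)}$ denotes the unique $[d]$ with $(G',j',\pi')\cong(d\boxtimes G,j,\pi)$. For $e\in Z^2(Q,Z(K))$, $e\boxtimes G$ is the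 set $G$ with multiplication $(g_1,g_2)\mapsto e(\pi(g_1),\pi(g_2))\cdot g_1\cdot g_2$; $[e]\mapsto(e\boxtimes G,i,\pi)$ is a bijection $-\boxtimes G$ from $H^2(Q,Z(K))$ to isomorphism classes of extensions of $K$ by $Q$ with outer action $\theta$, restricting to a bijection from $H^2_P(Q,Z(K))$ to the classes whose $P$-subextension is isomorphic to $(N,i_0,\pi_0)$; $\frac{(G',i',\pi')}{(G,i,\pi)}$ denotes the unique $[e]$ with $(G',i',\pi')\cong(e\boxtimes G,i,\pi)$. *)

(* Defs.v *)
From HB Require Import structures.
From mathcomp Require Import all_boot boolp classical_sets.

Set Implicit Arguments.
Unset Strict Implicit.
Unset Printing Implicit Defensive.

Local Open Scope quotient_scope.
Local Open Scope group_scope.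
Local Open Scope classical_set_scope.

(* Groups are groupTypes, which may be infinite; the choiceType they require
   exists on any type classically (gen_choiceMixin). *)

Notation "{ 'ghom' G -> H }" := (UMagmaMorphism.type G H)
  (at level 0, G at level 98, H at level 99,
   format "{ 'ghom'  G  ->  H }") : type_scope.

Section FunctionGroup.
Variables (T : Type) (G : groupType).
Implicit Types f g : T -> G.

Let fmul f g : T -> G := fun t => f t * g t.
Let fone : T -> G := fun=> 1.
Let finv f : T -> G := fun t => (f t)^-1.

Fact fmulA : associative fmul.
Proof. by move=> f g h; apply/funext => t; rewrite /fmul mulgA. Qed.
Fact fmul1 : left_id fone fmul.
Proof. by move=> f; apply/funext => t; rewrite /fmul mul1g. Qed.
Fact fmulr1 : right_id fone fmul.
Proof. by move=> f; apply/funext => t; rewrite /fmul mulg1. Qed.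
Fact fmulV : left_inverse fone finv fmul.
Proof. by move=> f; apply/funext => t; rewrite /fmul /finv mulVg. Qed.
Fact fmulrV : right_inverse fone finv fmul.
Proof. by move=> f; apply/funext => t; rewrite /fmul /finv mulgV. Qed.

HB.instance Definition _ :=
  isGroup.Build (T -> G) fmulA fmul1 fmulr1 fmulV fmulrV.

Lemma fun_mulE f g t : (f * g) t = f t * g t. Proof. by []. Qed.
Lemma fun_invE f t : f^-1 t = (f t)^-1. Proof. by []. Qed.
Lemma fun_oneE t : (1 : T -> G) t = 1. Proof. by []. Qed.
End FunctionGroup.

Fact mk_ghom_subproof (G H : groupType) (f : G -> H) :
  {morph f : x y / x * y} -> monoid_morphism f.
Proof. by move=> fM; split=> //; apply: (@mulgI _ (f 1)); rewrite -fM !mulg1. Qed.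

Definition mk_ghom (G H : groupType) (f : G -> H)
    (fM : {morph f : x y / x * y}) : {ghom G -> H} :=
  HB.pack f (isUMagmaMorphism.Build G H f (mk_ghom_subproof fM)).

Record subgroup (G : groupType) := Subgroup {
  sg_pred :> {pred G};
  sg_closed : group_closed sg_pred
}.

Record sg_type (G : groupType) (S : subgroup G) := SgElt {
  sg_val : G;
  sg_valP : sg_val \in (S : {pred G})
}.

Section SubgroupType.
Variables (G : groupType) (S : subgroup G).
HB.instance Definition _ := [isSub for @sg_val G S].
HB.instance Definition _ := [Choice of sg_type S by <:].
HB.instance Definition _ :=
  SubChoice_isSubGroup.Build G (mem S) (sg_type S) (sg_closed S).

Lemma sg_inj (x y : sg_type S) : sg_val x = sg_val y -> x = y.
Proof. exact: val_inj. Qed.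

Lemma sg_valM (x y : sg_type S) : sg_val (x * y) = sg_val x * sg_val y.
Proof. exact: valM. Qed.

Definition sg_ghom : {ghom sg_type S -> G} := mk_ghom sg_valM.

Lemma sg_val1 : sg_val (1 : sg_type S) = 1.
Proof. exact: (gmulf1 (s := sg_ghom)). Qed.
Lemma sg_valV (x : sg_type S) : sg_val x^-1 = (sg_val x)^-1.
Proof. exact: gmulfV sg_ghom x. Qed.
End SubgroupType.

Record normal_subgroup (G : groupType) := NormalSubgroup {
  ns_sub :> subgroup G;
  ns_norm : forall x y, x \in (ns_sub : {pred G}) -> x ^ y \in (ns_sub : {pred G})
}.

Section QuotientGroup.
Variables (G : groupType) (S : normal_subgroup G).

Let S1 : 1 \in (S : {pred G}) := (sg_closed S).1.
Let SV := group_closedV (sg_closed S).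
Let SM := group_closedM (sg_closed S).

Definition qg_rel (x y : G) : bool := x / y \in (S : {pred G}).

Fact qg_rel_refl : reflexive qg_rel.
Proof. by move=> x; rewrite /qg_rel divgg S1. Qed.
Fact qg_rel_sym : symmetric qg_rel.
Proof.
by move=> x y; rewrite /qg_rel; apply/idP/idP => /SV; rewrite invgF.
Qed.
Fact qg_rel_trans : transitive qg_rel.
Proof. by move=> y x z xy yz; have := SM xy yz; rewrite divgKA. Qed.

Canonical qg_equiv := EquivRel qg_rel qg_rel_refl qg_rel_sym qg_rel_trans.

Definition quog : Type := {eq_quot qg_equiv}.
HB.instance Definition _ := Choice.on quog.
HB.instance Definition _ := EqQuotient.on quog.

Definition qcls (x : G) : quog := \pi_quog x.

Lemma qclsP x y : reflect (qcls x = qcls y) (x / y \in (S : {pred G})).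
Proof. exact: (@eqquotP _ _ quog). Qed.

Lemma qcls_repr c : qcls (repr c) = c. Proof. exact: reprK. Qed.

Lemma qcls_surj c : exists x, qcls x = c.
Proof. by exists (repr c); rewrite qcls_repr. Qed.

Let qmul (a b : quog) : quog := qcls (repr a * repr b).
Let qone : quog := qcls 1.
Let qinv (a : quog) : quog := qcls (repr a)^-1.

Let qmulE x y : qmul (qcls x) (qcls y) = qcls (x * y).
Proof.
apply/qclsP; set x' := repr _; set y' := repr _.
have xx : x' / x \in (S : {pred G}) by apply/qclsP; rewrite qcls_repr.
have yy : y' / y \in (S : {pred G}) by apply/qclsP; rewrite qcls_repr.
have := SM (ns_norm x'^-1 yy) xx.
by rewrite conjgE invgK !invgM !mulgA mulgVK.
Qed.

Let qinvE x : qinv (qcls x) = qcls x^-1.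
Proof.
apply/qclsP; set x' := repr _.
have xx : x / x' \in (S : {pred G}) by apply/qclsP; rewrite qcls_repr.
have := ns_norm x xx.
by rewrite conjgE invgK !mulgA mulVg mul1g.
Qed.

Fact qmulA : associative qmul.
Proof.
move=> a b c; have [[x <-] [y <-] [z <-]] := And3 (qcls_surj a) (qcls_surj b) (qcls_surj c).
by rewrite !qmulE mulgA.
Qed.
Fact qmul1 : left_id qone qmul.
Proof. by move=> a; have [x <-] := qcls_surj a; rewrite qmulE mul1g. Qed.
Fact qmulr1 : right_id qone qmul.
Proof. by move=> a; have [x <-] := qcls_surj a; rewrite qmulE mulg1. Qed.
Fact qmulV : left_inverse qone qinv qmul.
Proof. by move=> a; have [x <-] := qcls_surj a; rewrite qinvE qmulE mulVg. Qed.
Fact qmulrV : right_inverse qone qinv qmul.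
Proof. by move=> a; have [x <-] := qcls_surj a; rewrite qinvE qmulE mulgV. Qed.

HB.instance Definition _ := isGroup.Build quog qmulA qmul1 qmulr1 qmulV qmulrV.

Fact qcls_is_morphism : monoid_morphism qcls.
Proof. by split=> // x y; rewrite -qmulE. Qed.
HB.instance Definition _ := isUMagmaMorphism.Build G quog qcls qcls_is_morphism.

Lemma qclsM x y : qcls (x * y) = qcls x * qcls y. Proof. exact: gmulfM. Qed.
Lemma qcls1 : qcls 1 = 1. Proof. exact: gmulf1. Qed.

End QuotientGroup.

Section QuotientMap.
Variables (G G' : groupType) (S : normal_subgroup G) (S' : normal_subgroup G').
Variable f : {ghom G -> G'}.
Hypothesis fS : forall x, x \in (S : {pred G}) -> f x \in (S' : {pred G'}).

Definition quog_fun (c : quog S) : quog S' := qcls S' (f (repr c)).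

Lemma quog_funE x : quog_fun (qcls S x) = qcls S' (f x).
Proof.
by apply/qclsP; rewrite -gmulfF; apply: fS; apply/qclsP; rewrite qcls_repr.
Qed.

Fact quog_funM : {morph quog_fun : a b / a * b}.
Proof.
move=> a b; have [[x <-] [y <-]] := conj (qcls_surj a) (qcls_surj b).
by rewrite -gmulfM !quog_funE !gmulfM.
Qed.
Definition quog_map : {ghom quog S -> quog S'} := mk_ghom quog_funM.

Lemma quog_mapE x : quog_map (qcls S x) = qcls S' (f x).
Proof. exact: quog_funE. Qed.
End QuotientMap.

(* The product of the group aut G is composition, so that g |-> inn g, where
   inn g is x |-> g x g^-1, is a homomorphism. *)
Record aut (G : groupType) := Aut {
  aut_fun :> G -> G;
  autM : {morph aut_fun : x y / x * y};
  aut_bij : bijective aut_fun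
}.

Section AutomorphismGroup.
Variable G : groupType.
Implicit Types a b : aut G.

HB.instance Definition _ := gen_eqMixin (aut G).
HB.instance Definition _ := gen_choiceMixin (aut G).

Lemma autP a b : a =1 b -> a = b.
Proof.
case: a b => [f fM fB] [g gM gB] /= /funext fg; case: _ / fg in gM gB *.
by congr Aut; exact: Prop_irrelevance.
Qed.

Let aone : aut G := @Aut G id (fun x y => erefl) (Bijective (fun=> erefl) (fun=> erefl)).

Fact amulM a b : {morph a \o b : x y / x * y}.
Proof. by move=> x y; rewrite /= !autM. Qed.
Let amul a b : aut G := Aut (@amulM a b) (bij_comp (aut_bij a) (aut_bij b)).

Fact ainv_subproof a : exists b, (forall x, b (a x) = x) /\ (forall x, a (b x) = x).
Proof.
have [g fK gK] := aut_bij a.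
have gM : {morph g : x y / x * y} by move=> x y; apply: (can_inj fK); rewrite autM !gK.
by exists (@Aut G g gM (Bijective gK fK)).
Qed.
Let ainv a : aut G := sval (cid (ainv_subproof a)).

Fact amulA : associative amul. Proof. by move=> a b c; apply: autP. Qed.
Fact amul1 : left_id aone amul. Proof. by move=> a; apply: autP. Qed.
Fact amulr1 : right_id aone amul. Proof. by move=> a; apply: autP. Qed.
Fact amulV : left_inverse aone ainv amul.
Proof. by move=> a; apply: autP => x /=; rewrite /ainv; case: cid => b [] /=. Qed.
Fact amulrV : right_inverse aone ainv amul.
Proof. by move=> a; apply: autP => x /=; rewrite /ainv; case: cid => b [] /=. Qed.

HB.instance Definition _ := isGroup.Build (aut G) amulA amul1 amulr1 amulV amulrV.

Lemma aut_mulE a b x : (a * b) x = a (b x). Proof. by []. Qed.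
Lemma aut_oneE x : (1 : aut G) x = x. Proof. by []. Qed.
Lemma autK a : cancel a a^-1.
Proof. by move=> x; rewrite -aut_mulE mulVg. Qed.
Lemma autVK a : cancel a^-1 a.
Proof. by move=> x; rewrite -aut_mulE mulgV. Qed.
Lemma aut1 a : a 1 = 1.
Proof. by apply: (@mulgI _ (a 1)); rewrite -autM !mulg1. Qed.
Lemma autV a x : a x^-1 = (a x)^-1.
Proof. by apply: (@mulgI _ (a x)); rewrite -autM !mulgV aut1. Qed.

Fact inn_morph (x : G) : {morph (fun y => x * y * x^-1) : y z / y * z}.
Proof. by move=> y z; rewrite !mulgA mulgVK. Qed.
Fact inn_bij (x : G) : bijective (fun y => x * y * x^-1).
Proof.
exists (fun y => x^-1 * y * x) => y; first by rewrite !mulgA mulgVK mulVg mul1g.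
by rewrite !mulgA mulgK mulgV mul1g.
Qed.
Definition inn (x : G) : aut G := Aut (@inn_morph x) (@inn_bij x).

Lemma innE x y : inn x y = x * y * x^-1. Proof. by []. Qed.

Fact inn_is_morphism : monoid_morphism inn.
Proof.
split=> [|x y]; apply: autP => z; rewrite ?aut_mulE /=; first by rewrite invg1 mul1g mulg1.
by rewrite invgM !mulgA.
Qed.
HB.instance Definition _ := isUMagmaMorphism.Build G (aut G) inn inn_is_morphism.

Lemma inn_conj a x : inn x ^ a = inn (a^-1 x).
Proof. by apply: autP => y; rewrite conjgE !aut_mulE !innE !autM !autV autK. Qed.

End AutomorphismGroup.

Section Outer.
Variable K : groupType.

Definition inn_pred : {pred aut K} := fun a => `[< exists x, a = inn x >].
Lemma inn_predP a : reflect (exists x, a = inn x) (a \in inn_pred).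
Proof. exact: asboolP. Qed.

Fact inn_closed : group_closed inn_pred.
Proof.
split=> [|a b /inn_predP[x ->] /inn_predP[y ->]]; apply/inn_predP.
  by exists 1; rewrite gmulf1.
by exists (x / y); rewrite gmulfF.
Qed.
Fact inn_norm a b : a \in inn_pred -> a ^ b \in inn_pred.
Proof. by move=> /inn_predP[x ->]; apply/inn_predP; exists (b^-1 x); rewrite inn_conj. Qed.
Definition Inn : normal_subgroup (aut K) :=
  @NormalSubgroup _ (Subgroup inn_closed) inn_norm.
Definition Out : groupType := quog Inn.
End Outer.

Record extension (K Q : groupType) := Extension {
  ext_grp :> groupType;
  ext_inj : {ghom K -> ext_grp};
  ext_prj : {ghom ext_grp -> Q};
  ext_injI : injective ext_inj;
  ext_prjS : forall q, exists g, ext_prj g = q;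
  ext_exact : forall g, ext_prj g = 1 <-> exists k, g = ext_inj k
}.

Definition ext_iso (K Q : groupType) (E1 E2 : extension K Q) : Prop :=
  exists f : {ghom E1 -> E2},
    [/\ bijective f,
        forall k, f (ext_inj E1 k) = ext_inj E2 k
      & forall g, ext_prj E2 (f g) = ext_prj E1 g].

(* Conjugation by g preserves i(K) = Ker(pi), so the automorphism a below always
   exists and is unique; as pi is onto, at most one theta satisfies this. *)
Definition has_outer_action (K Q : groupType) (E : extension K Q)
    (theta : {ghom Q -> Out K}) : Prop :=
  forall g : E, exists2 a : aut K,
    forall k, ext_inj E (a k) = g * ext_inj E k * g^-1
    & theta (ext_prj E g) = qcls (Inn K) a.

(* Modules are written multiplicatively, and cochains are curried. *)
Record gmodule (H : groupType) := GModule {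
  gm_grp :> groupType;
  gm_mulC : commutative (@mul gm_grp);
  gact : H -> gm_grp -> gm_grp;
  gact1 : forall a, gact 1 a = a;
  gactM : forall g h a, gact (g * h) a = gact g (gact h a);
  gact_mul : forall g, {morph gact g : a b / a * b}
}.

Section Cohomology.
Variables (H : groupType) (A : gmodule H).
Implicit Types d : H -> H -> A.

Lemma gactr1 h : gact h (1 : A) = 1.
Proof. by apply: (@mulgI _ (gact h (1 : A))); rewrite -gact_mul !mulg1. Qed.
Lemma gactV h (a : A) : gact h a^-1 = (gact h a)^-1.
Proof. by apply: (@mulgI _ (gact h a)); rewrite -gact_mul !mulgV gactr1. Qed.

Lemma gm_mulACA (a b c e : A) : (a * b) * (c * e) = (a * c) * (b * e).
Proof. by rewrite -!mulgA; congr (_ * _); rewrite !mulgA (gm_mulC b). Qed.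
Lemma gm_invM (a b : A) : (a * b)^-1 = a^-1 * b^-1.
Proof. by rewrite invgM gm_mulC. Qed.
Lemma gm_divM (a b c e : A) : (a * b) / (c * e) = (a / c) * (b / e).
Proof. by rewrite gm_invM gm_mulACA. Qed.
Lemma gm_divV (a b : A) : a^-1 / b^-1 = (a / b)^-1.
Proof. by rewrite gm_invM. Qed.

(* The first two clauses are normalization. *)
Definition is_cocycle2 d : Prop :=
  [/\ forall h, d 1 h = 1, forall h, d h 1 = 1
    & forall h1 h2 h3,
        d h1 h2 * d (h1 * h2) h3 = gact h1 (d h2 h3) * d h1 (h2 * h3)].

Definition is_coboundary2 d : Prop :=
  exists2 z : H -> A, z 1 = 1
    & forall h1 h2, d h1 h2 = z h1 * gact h1 (z h2) * (z (h1 * h2))^-1.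

Definition cocycle2_pred : {pred H -> H -> A} := fun d => `[< is_cocycle2 d >].

Fact cocycle2_closed : group_closed cocycle2_pred.
Proof.
split; first by apply/asboolP; split=> // *; rewrite ?gactr1 // !fun_oneE gactr1.
move=> d e /asboolP[d1 dr1 dc] /asboolP[e1 er1 ec]; apply/asboolP.
split=> [h|h|h1 h2 h3]; rewrite !fun_mulE !fun_invE.
- by rewrite d1 e1 divgg.
- by rewrite dr1 er1 divgg.
- by rewrite gact_mul gactV -!gm_divM dc ec.
Qed.

Definition Z2 : subgroup (H -> H -> A) := Subgroup cocycle2_closed.

Definition coboundary2_pred : {pred sg_type Z2} :=
  fun c => `[< is_coboundary2 (sg_val c) >].

Fact coboundary2_closed : group_closed coboundary2_pred.
Proof.
split.
  apply/asboolP; exists (fun=> 1) => // h1 h2.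
  by rewrite sg_val1 !fun_oneE gactr1 mulg1 mulgV.
move=> d e /asboolP[z z1 zE] /asboolP[y y1 yE]; apply/asboolP.
exists (fun h => z h / y h) => [|h1 h2]; first by rewrite z1 y1 divgg.
rewrite sg_valM sg_valV !fun_mulE !fun_invE zE yE.
by rewrite gact_mul gactV [LHS]gm_divM gm_divM gm_divV.
Qed.

Lemma Z2_mulC (c d : sg_type Z2) : c * d = d * c.
Proof.
apply: sg_inj; rewrite !sg_valM; apply/funext => h1; apply/funext => h2.
by rewrite !fun_mulE gm_mulC.
Qed.

Fact coboundary2_norm (c d : sg_type Z2) :
  c \in coboundary2_pred -> c ^ d \in coboundary2_pred.
Proof. by move=> cB; rewrite conjgE mulgA Z2_mulC mulgA mulgV mul1g. Qed.

Definition B2 : normal_subgroup (sg_type Z2) :=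
  @NormalSubgroup _ (Subgroup coboundary2_closed) coboundary2_norm.

Definition H2 : groupType := quog B2.

Lemma H2_eqP (d e : sg_type Z2) :
  qcls B2 d = qcls B2 e <-> is_coboundary2 (sg_val (d / e)).
Proof. by split=> [/qclsP/asboolP|dB] //; apply/qclsP/asboolP. Qed.

End Cohomology.

Section Pullback.
Variables (H H' : groupType) (phi : {ghom H -> H'}).
Variables (A' : gmodule H') (A : gmodule H) (f : {ghom A' -> A}).
Hypothesis f_act : forall h a, f (gact (phi h) a) = gact h (f a).

Definition cochain_pull (d : H' -> H' -> A') : H -> H -> A :=
  fun h1 h2 => f (d (phi h1) (phi h2)).

Fact Z2_pull_subproof (d : sg_type (Z2 A')) :
  cochain_pull (sg_val d) \in (Z2 A : {pred H -> H -> A}).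
Proof.
apply/asboolP; have /asboolP[d1 dr1 dc] := sg_valP d.
split=> [h|h|h1 h2 h3]; rewrite /cochain_pull ?gmulf1 ?d1 ?dr1 ?gmulf1 //.
by have := congr1 f (dc (phi h1) (phi h2) (phi h3)); rewrite !gmulfM f_act.
Qed.

Definition Z2_pull_fun (d : sg_type (Z2 A')) : sg_type (Z2 A) :=
  @SgElt _ (Z2 A) _ (Z2_pull_subproof d).

Lemma Z2_pull_funE d h1 h2 :
  sg_val (Z2_pull_fun d) h1 h2 = f (sg_val d (phi h1) (phi h2)).
Proof. by []. Qed.

Fact Z2_pullM : {morph Z2_pull_fun : d e / d * e}.
Proof.
move=> d e; apply: sg_inj; apply/funext => h1; apply/funext => h2.
rewrite [in RHS]sg_valM !fun_mulE !Z2_pull_funE.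
by rewrite [in LHS]sg_valM !fun_mulE gmulfM.
Qed.
Definition Z2_pull : {ghom sg_type (Z2 A') -> sg_type (Z2 A)} := mk_ghom Z2_pullM.

Fact Z2_pull_coboundary d :
  d \in (B2 A' : {pred _}) -> Z2_pull d \in (B2 A : {pred _}).
Proof.
move=> /asboolP[z z1 zE]; apply/asboolP; exists (fun h => f (z (phi h))).
  by rewrite gmulf1 z1 gmulf1.
move=> h1 h2; rewrite [LHS]Z2_pull_funE zE.
by rewrite -(gmulfM (s := phi)) !(gmulfM (s := f)) gmulfV f_act.
Qed.

Definition H2_pull : {ghom H2 A' -> H2 A} := quog_map Z2_pull_coboundary.

Lemma H2_pullE d : H2_pull (qcls (B2 A') d) = qcls (B2 A) (Z2_pull d).
Proof. exact: quog_mapE. Qed.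
End Pullback.

Section Restriction.
Variables (P Q : groupType) (j : {ghom P -> Q}) (A : gmodule Q).

Definition gmodule_res : gmodule P.
Proof.
exists A (fun p => gact (j p)); first exact: gm_mulC.
- by move=> a; rewrite gmulf1 gact1.
- by move=> p q a; rewrite gmulfM gactM.
- by move=> p; apply: gact_mul.
Defined.

Definition gmodule_res_id : {ghom A -> gmodule_res} :=
  mk_ghom (H := gmodule_res) (f := fun a : A => a) (fun x y => erefl).

Fact gmodule_res_act p a :
  gmodule_res_id (gact (j p) a) = gact p (gmodule_res_id a).
Proof. by []. Qed.

Definition H2_res : {ghom H2 A -> H2 gmodule_res} := H2_pull gmodule_res_act.

Lemma H2_resE d :
  H2_res (qcls (B2 A) d) = qcls (B2 gmodule_res) (Z2_pull gmodule_res_act d).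
Proof. exact: H2_pullE. Qed.
End Restriction.
Section Center.
Variable K : groupType.

Definition center_pred : {pred K} := fun z => `[< forall k, z * k = k * z >].
Fact center_closed : group_closed center_pred.
Proof.
split; first by apply/asboolP => k; rewrite mul1g mulg1.
move=> x y /asboolP xC /asboolP yC; apply/asboolP => k.
have yVC : commute k y^-1 by apply: commuteV; rewrite /commute yC.
by rewrite -mulgA -yVC !mulgA xC.
Qed.
Definition center : subgroup K := Subgroup center_closed.

Lemma centerC (z : sg_type center) k : sg_val z * k = k * sg_val z.
Proof. by have /asboolP := sg_valP z; exact. Qed.

Lemma center_mulC (y z : sg_type center) : y * z = z * y.
Proof. by apply: sg_inj; rewrite !sg_valM centerC. Qed.

Fact center_act_subproof (a : aut K) (z : sg_type center) :
  a (sg_val z) \in (center : {pred K}).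
Proof. by apply/asboolP => k; rewrite -[k](autVK a) -!autM centerC. Qed.
Definition center_act (a : aut K) (z : sg_type center) : sg_type center :=
  SgElt (center_act_subproof a z).

Lemma center_act_qcls a b z :
  qcls (Inn K) a = qcls (Inn K) b -> center_act a z = center_act b z.
Proof.
move=> /qclsP/inn_predP[x abx]; apply: sg_inj; rewrite /=.
have -> : a = inn x * b by rewrite -abx mulgVK.
rewrite aut_mulE innE.
by have /asboolP <- := center_act_subproof b z; rewrite mulgK.
Qed.

Section CenterModule.
Variables (Q : groupType) (theta : {ghom Q -> Out K}).

(* Independent of the representative, since inner automorphisms fix the centre
   pointwise: see ZK_actE. *)
Definition ZK_act (q : Q) (z : sg_type center) : sg_type center :=
  center_act (repr (theta q)) z.

Lemma ZK_actE q a z : theta q = qcls (Inn K) a -> ZK_act q z = center_act a z.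
Proof. by move=> qa; apply: center_act_qcls; rewrite qcls_repr. Qed.

Definition ZK : gmodule Q.
Proof.
exists (sg_type center) ZK_act; first exact: center_mulC.
- move=> z; rewrite (@ZK_actE 1 1); [exact: sg_inj | by rewrite gmulf1 qcls1].
- move=> g h z; rewrite (@ZK_actE _ (repr (theta g) * repr (theta h))).
    exact: sg_inj.
  by rewrite gmulfM qclsM !qcls_repr.
- move=> g y z; apply: sg_inj; rewrite [in RHS]sg_valM.
  by rewrite -[RHS]autM -[in RHS]sg_valM.
Defined.
End CenterModule.
End Center.

Lemma ext_prj_inj (K Q : groupType) (E : extension K Q) k :
  ext_prj E (ext_inj E k) = 1.
Proof. by apply/ext_exact; exists k. Qed.

Section FixedPoints.
Variables (P R : groupType) (PQR : extension P R) (A : gmodule PQR).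
Let jb := ext_inj PQR.
Let fb := ext_prj PQR.

Definition fixed_pred : {pred A} := fun z => `[< forall p, gact (jb p) z = z >].
Fact fixed_closed : group_closed fixed_pred.
Proof.
split; first by apply/asboolP => p; rewrite gactr1.
move=> x y /asboolP xP /asboolP yP; apply/asboolP => p.
by rewrite gact_mul gactV xP yP.
Qed.
Definition fixed : subgroup A := Subgroup fixed_closed.

Lemma fixedP (z : sg_type fixed) p : gact (jb p) (sg_val z) = sg_val z.
Proof. by have /asboolP := sg_valP z; exact. Qed.

Fact fixed_act_subproof (q : PQR) (z : sg_type fixed) :
  gact q (sg_val z) \in (fixed : {pred A}).
Proof.
apply/asboolP => p.
have [p' p'E] : exists p', q^-1 * jb p * q = jb p'.
  apply/ext_exact; rewrite !gmulfM gmulfV.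
  by rewrite ext_prj_inj mulg1 mulVg.
by rewrite -gactM -(mulVKg q (jb p * q)) (mulgA q^-1) p'E gactM fixedP.
Qed.

Definition fixed_lift (r : R) : PQR := sval (cid (ext_prjS PQR r)).
Lemma fixed_liftK r : fb (fixed_lift r) = r.
Proof. exact: svalP (cid (ext_prjS PQR r)). Qed.

(* Independent of the lift of r to the middle group: see fixed_actE. *)
Definition fixed_act (r : R) (z : sg_type fixed) : sg_type fixed :=
  SgElt (fixed_act_subproof (fixed_lift r) z).

Lemma fixed_actE r q z : fb q = r -> sg_val (fixed_act r z) = gact q (sg_val z).
Proof.
move=> qr /=; have [p pE] : exists p, q^-1 * fixed_lift r = jb p.
  by apply/ext_exact; rewrite gmulfM gmulfV fixed_liftK qr mulVg.
by rewrite -(mulVKg q (fixed_lift r)) pE gactM fixedP.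
Qed.

Definition fixed_module : gmodule R.
Proof.
exists (sg_type fixed) fixed_act.
- by move=> y z; apply: sg_inj; rewrite !sg_valM gm_mulC.
- by move=> z; apply: sg_inj; rewrite (@fixed_actE _ 1) ?gact1 ?gmulf1.
- move=> r s z; apply: sg_inj.
  rewrite (@fixed_actE _ (fixed_lift r * fixed_lift s)) ?gmulfM ?fixed_liftK //.
  by rewrite gactM.
- move=> r y z; apply: sg_inj; rewrite [in RHS]sg_valM.
  by rewrite -[RHS]gact_mul -[in RHS]sg_valM.
Defined.

(* The inclusion of the fixed points is equivariant along the projection; its
   pullback on cocycles is inflation. *)
Lemma fixed_infl_act (q : PQR) (z : fixed_module) :
  sg_ghom fixed (gact (fb q) z) = gact q (sg_ghom fixed z).
Proof. exact: fixed_actE. Qed.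

Definition Z2_infl : {ghom sg_type (Z2 fixed_module) -> sg_type (Z2 A)} :=
  Z2_pull fixed_infl_act.

Definition infl_all : {ghom H2 fixed_module -> H2 A} := H2_pull fixed_infl_act.

Definition H2P_pred : {pred H2 A} := fun c => H2_res jb A c == 1.
Fact H2P_closed : group_closed H2P_pred.
Proof.
split; first by apply/eqP; rewrite gmulf1.
by move=> x y /eqP x1 /eqP y1; apply/eqP; rewrite gmulfF x1 y1 divgg.
Qed.
Definition H2P : subgroup (H2 A) := Subgroup H2P_closed.

Fact infl_subproof c : infl_all c \in (H2P : {pred H2 A}).
Proof.
apply/eqP; have [d <-] := qcls_surj c; rewrite /infl_all H2_pullE H2_resE -qcls1.
congr (qcls _ _); apply: sg_inj; apply/funext => p1; apply/funext => p2.
rewrite sg_val1 [LHS]Z2_pull_funE [LHS]Z2_pull_funE !ext_prj_inj.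
by have /asboolP[-> _ _] := sg_valP d.
Qed.

Definition infl_fun (c : H2 fixed_module) : sg_type H2P := SgElt (infl_subproof c).

Fact inflM : {morph infl_fun : c d / c * d}.
Proof. by move=> c d; apply: sg_inj; rewrite sg_valM; apply: gmulfM. Qed.
Definition infl : {ghom H2 fixed_module -> sg_type H2P} := mk_ghom inflM.

Lemma inflE d : sg_val (infl (qcls _ d)) = qcls _ (Z2_infl d).
Proof. exact: H2_pullE. Qed.
End FixedPoints.
Section OuterModK.
Variables (K P : groupType) (KNP : extension K P).
Local Notation N := (ext_grp KNP).
Local Notation i0 := (ext_inj KNP).

Definition autK_pred : {pred aut N} :=
  fun a => `[< a @` range i0 = range i0 >].
Fact autK_closed : group_closed autK_pred.
Proof.
split; first by apply/asboolP; exact: image_id.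
move=> a b /asboolP aK /asboolP bK; apply/asboolP.
rewrite -[RHS]aK -{1}bK (image_comp b); apply: eq_imagel => x _.
exact (congr1 a (autK b x)).
Qed.
Definition AutK : subgroup (aut N) := Subgroup autK_closed.

Definition innK_pred : {pred sg_type AutK} :=
  fun a => `[< exists k, sg_val a = inn (i0 k) >].
Fact innK_closed : group_closed innK_pred.
Proof.
split; first by apply/asboolP; exists 1; rewrite sg_val1 !gmulf1.
move=> a b /asboolP[x ax] /asboolP[y bY]; apply/asboolP; exists (x / y).
by rewrite sg_valM sg_valV ax bY !gmulfF.
Qed.
Fact innK_norm a b : a \in innK_pred -> a ^ b \in innK_pred.
Proof.
move=> /asboolP[x ax]; apply/asboolP.
have : range i0 (i0 x) by exists x.
have /asboolP <- := sg_valP b => -[_ [y _ <-]] yx; exists y.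
by rewrite conjgE !sg_valM sg_valV ax -yx -conjgE inn_conj autK.
Qed.
Definition InnK : normal_subgroup (sg_type AutK) :=
  @NormalSubgroup _ (Subgroup innK_closed) innK_norm.
Definition OutK : groupType := quog InnK.
End OuterModK.

Record iterext (K P R : groupType) (KNP : extension K P) (PQR : extension P R) :=
  IterExt {
    ie_grp :> groupType;
    ie_j : {ghom KNP -> ie_grp};
    ie_pi : {ghom ie_grp -> PQR};
    ie_jI : injective ie_j;
    ie_piS : forall q, exists g, ie_pi g = q;
    ie_comm : forall n, ie_pi (ie_j n) = ext_inj PQR (ext_prj KNP n);
    ie_ker_phi : forall g, ext_prj PQR (ie_pi g) = 1 <-> exists n, g = ie_j n;
    ie_ker_pi : forall g, ie_pi g = 1 <-> exists k, g = ie_j (ext_inj KNP k)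
  }.

Definition ghom_comp (G H L : groupType) (g : {ghom H -> L}) (f : {ghom G -> H}) :
  {ghom G -> L} := mk_ghom (f := g \o f) (fun x y =>
    etrans (congr1 g (gmulfM x y)) (gmulfM (f x) (f y))).

Section IteratedExtension.
Variables (K P R : groupType) (KNP : extension K P) (PQR : extension P R).
Implicit Types G : iterext KNP PQR.

Definition main_ext G : extension K PQR :=
  @Extension K PQR G (ghom_comp (ie_j G) (ext_inj KNP)) (ie_pi G)
    (inj_comp (@ie_jI _ _ _ _ _ G) (@ext_injI _ _ KNP)) (@ie_piS _ _ _ _ _ G)
    (@ie_ker_pi _ _ _ _ _ G).

Definition iterext_iso G1 G2 : Prop :=
  exists f : {ghom G1 -> G2},
    [/\ bijective f,
        forall n, f (ie_j G1 n) = ie_j G2 n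
      & forall g, ie_pi G2 (f g) = ie_pi G1 g].

Definition has_modK_action G (Theta : {ghom PQR -> OutK KNP}) : Prop :=
  forall g : G, exists2 a : sg_type (AutK KNP),
    forall n, ie_j G (sg_val a n) = g * ie_j G n * g^-1
    & Theta (ie_pi G g) = qcls (InnK KNP) a.
End IteratedExtension.

Section Subextension.
Variables (K P R : groupType) (PQR : extension P R) (E : extension K PQR).
Local Notation jb := (ext_inj PQR).

Definition preimP_pred : {pred E} := fun g => `[< exists p, ext_prj E g = jb p >].
Fact preimP_closed : group_closed preimP_pred.
Proof.
split; first by apply/asboolP; exists 1; rewrite !gmulf1.
move=> x y /asboolP[p xp] /asboolP[q yq]; apply/asboolP; exists (p / q).
by rewrite !gmulfF xp yq.
Qed.
Definition preimP : subgroup E := Subgroup preimP_closed.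

Fact subext_inj_subproof k : ext_inj E k \in (preimP : {pred E}).
Proof. by apply/asboolP; exists 1; rewrite ext_prj_inj gmulf1. Qed.
Definition subext_inj_fun k : sg_type preimP := SgElt (subext_inj_subproof k).
Fact subext_injM : {morph subext_inj_fun : x y / x * y}.
Proof. by move=> x y; apply: sg_inj; rewrite [RHS]sg_valM; apply: gmulfM. Qed.

Fact subext_prj_subproof (g : sg_type preimP) :
  exists p, ext_prj E (sg_val g) = jb p.
Proof. by have /asboolP := sg_valP g. Qed.
Definition subext_prj_fun g : P := sval (cid (subext_prj_subproof g)).
Lemma subext_prj_funE g : jb (subext_prj_fun g) = ext_prj E (sg_val g).
Proof. by rewrite [RHS](svalP (cid (subext_prj_subproof g))). Qed.
Fact subext_prjM : {morph subext_prj_fun : x y / x * y}.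
Proof.
move=> x y; apply: (@ext_injI _ _ PQR).
by rewrite [RHS]gmulfM !subext_prj_funE [in LHS]sg_valM gmulfM.
Qed.

Definition subext : extension K P.
Proof.
apply: (@Extension K P (sg_type preimP) (mk_ghom subext_injM) (mk_ghom subext_prjM)).
- by move=> x y /(congr1 (@sg_val _ _))/ext_injI.
- move=> p; have [g gp] := ext_prjS E (jb p).
  have gP : g \in (preimP : {pred E}) by apply/asboolP; exists p.
  by exists (SgElt gP); apply: (@ext_injI _ _ PQR); rewrite [LHS]subext_prj_funE.
- move=> g; split=> [g1|[k ->]].
    have /ext_exact[k gk] : ext_prj E (sg_val g) = 1.
      by rewrite -subext_prj_funE [subext_prj_fun g]g1 gmulf1.
    by exists k; apply: sg_inj.
  apply: (@ext_injI _ _ PQR); rewrite [LHS]subext_prj_funE gmulf1.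
  exact: ext_prj_inj.
Defined.
End Subextension.

Record is_twist (G : groupType) (c : G -> G -> G) : Prop := IsTwist {
  tw1 : forall g, c 1 g = 1;
  twr1 : forall g, c g 1 = 1;
  twl : forall x y g h, c (c x y * g) h = c g h;
  twr : forall x y g h, c g (c x y * h) = c g h;
  twC : forall x y g h, c x y * c g h = c g h * c x y;
  twM : forall g h k, c g h * c (g * h) k = (g * c h k * g^-1) * c g (h * k)
}.

(* The set G with the product c g h * (g * h) (see twistedE). *)
Definition twisted (G : groupType) (c : G -> G -> G) of is_twist c : Type := G.

Section Twist.
Variables (G : groupType) (c : G -> G -> G) (cP : is_twist c).
Local Notation T := (twisted cP).

Definition tmul (g h : T) : T := c g h * ((g : G) * (h : G)).
Definition tinv (g : T) : T := (c (g : G)^-1 g)^-1 * (g : G)^-1.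

Lemma twlV x y g h : c ((c x y)^-1 * g) h = c g h.
Proof. by rewrite -(twl cP x y) mulVKg. Qed.
Lemma twrV x y g h : c g ((c x y)^-1 * h) = c g h.
Proof. by rewrite -(twr cP x y) mulVKg. Qed.

Lemma twJC x y g h k : commute (c x y) (g * c h k * g^-1).
Proof.
have -> : g * c h k * g^-1 = c g h * c (g * h) k / c g (h * k).
  by rewrite (twM cP) mulgK.
by apply: commuteM; [apply: commuteM | apply: commuteV]; apply: (twC cP).
Qed.

Fact tmulA : associative tmul.
Proof.
move=> g h k; rewrite /tmul (twl cP) (twr cP) !mulgA; congr (_ * _ * _).
rewrite (twC cP (g * h)) (twM cP) -twJC !mulgA mulgVK //.
Qed.
Fact tmul1 : left_id (1 : G) tmul.
Proof. by move=> g; rewrite /tmul (tw1 cP) !mul1g. Qed.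
Fact tmulr1 : right_id (1 : G) tmul.
Proof. by move=> g; rewrite /tmul (twr1 cP) mul1g mulg1. Qed.
Fact tmulV : left_inverse (1 : G) tinv tmul.
Proof. by move=> g; rewrite /tmul /tinv twlV mulgVK mulgV. Qed.
Fact tmulrV : right_inverse (1 : G) tinv tmul.
Proof.
move=> g; rewrite /tmul /tinv twrV.
have := twM cP g g^-1 g; rewrite mulgV mulVg (tw1 cP) (twr1 cP) !mulg1 => ->.
by rewrite !mulgA mulgVK mulgK mulgV.
Qed.

HB.instance Definition _ := Choice.on T.
HB.instance Definition _ := isGroup.Build T tmulA tmul1 tmulr1 tmulV tmulrV.

Lemma twistedE (g h : G) : (g : T) * (h : T) = c g h * (g * h) :> G.
Proof. by []. Qed.
End Twist.

Section ExtBox.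
Variables (K Q : groupType) (theta : {ghom Q -> Out K}) (E : extension K Q).
Hypothesis hE : has_outer_action E theta.
Local Notation i := (ext_inj E).
Local Notation pi := (ext_prj E).

Lemma ext_inj_act g (z : ZK theta) :
  i (sg_val (gact (pi g) z)) = g * i (sg_val z) * g^-1.
Proof.
by have [a aE thE] := hE g; rewrite [gact _ z](ZK_actE _ thE) -aE.
Qed.

(* The factor e(pi(g1), pi(g2)) of the product of e [x] E, as an element of E. *)
Definition ext_box_fun (e : sg_type (Z2 (ZK theta))) (g1 g2 : E) : E :=
  i (sg_val (sg_val e (pi g1) (pi g2))).

Fact ext_box_twist e : is_twist (ext_box_fun e).
Proof.
have /asboolP[e1 er1 ec] := sg_valP e.
have piK z g : pi (i z * g) = pi g by rewrite gmulfM ext_prj_inj mul1g.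
split=> *; rewrite /ext_box_fun ?piK //.
- by rewrite gmulf1 e1 sg_val1 gmulf1.
- by rewrite gmulf1 er1 sg_val1 gmulf1.
- by rewrite -!gmulfM centerC.
- by rewrite !gmulfM -ext_inj_act -!(gmulfM (s := i)) -!sg_valM ec.
Qed.

Lemma ext_box_mull e (g : E) k :
  (i k : twisted (ext_box_twist e)) * (g : twisted (ext_box_twist e)) = i k * g :> E.
Proof.
rewrite twistedE /ext_box_fun ext_prj_inj.
by have /asboolP[-> _ _] := sg_valP e; rewrite sg_val1 gmulf1 mul1g.
Qed.

Lemma ext_box_mulr e (g : E) k :
  (g : twisted (ext_box_twist e)) * (i k : twisted (ext_box_twist e)) = g * i k :> E.
Proof.
rewrite twistedE /ext_box_fun ext_prj_inj.
by have /asboolP[_ -> _] := sg_valP e; rewrite sg_val1 gmulf1 mul1g.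
Qed.

Fact ext_box_injM e : {morph (i : K -> twisted (ext_box_twist e)) : x y / x * y}.
Proof. by move=> x y; rewrite ext_box_mull; exact (@gmulfM _ _ i x y). Qed.
Fact ext_box_prjM e : {morph (pi : twisted (ext_box_twist e) -> Q) : x y / x * y}.
Proof. by move=> x y; rewrite twistedE !gmulfM ext_prj_inj mul1g. Qed.

Definition ext_box (e : sg_type (Z2 (ZK theta))) : extension K Q :=
  @Extension K Q (twisted (ext_box_twist e))
    (mk_ghom (@ext_box_injM e)) (mk_ghom (@ext_box_prjM e))
    (@ext_injI _ _ E) (@ext_prjS _ _ E) (@ext_exact _ _ E).

(* The class [e] with E' isomorphic to ext_box e. It exists and is unique when E'
   has outer action theta; the default value 1 of xget is then irrelevant. *)
Definition ext_ratio (E' : extension K Q) : H2 (ZK theta) :=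
  xget 1 [set c | exists2 e, c = qcls (B2 (ZK theta)) e & ext_iso E' (ext_box e)].
End ExtBox.
Section IsoEquivalence.

Lemma ghom_inv (G H : groupType) (f : {ghom G -> H}) : bijective f ->
  exists f' : {ghom H -> G}, cancel f f' /\ cancel f' f.
Proof.
case=> g fK gK.
have gM : {morph g : x y / x * y} by apply: can2_gmulfM fK gK.
by exists (mk_ghom gM).
Qed.

Lemma ext_iso_refl (K Q : groupType) (E : extension K Q) : ext_iso E E.
Proof.
exists (mk_ghom (f := fun g : E => g) (fun x y => erefl)); split=> //.
by exists (fun g => g).
Qed.

Lemma ext_iso_sym (K Q : groupType) (E1 E2 : extension K Q) :
  ext_iso E1 E2 -> ext_iso E2 E1.
Proof.
case=> f [/ghom_inv[f' [fK f'K]] fi fp]; exists f'; split.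
- by exists f.
- by move=> k; rewrite -fi fK.
- by move=> g; rewrite -fp f'K.
Qed.

Lemma ext_iso_trans (K Q : groupType) (E1 E2 E3 : extension K Q) :
  ext_iso E1 E2 -> ext_iso E2 E3 -> ext_iso E1 E3.
Proof.
case=> f [fb fi fp] [g [gb gi gp]]; exists (ghom_comp g f); split.
- exact: bij_comp.
- by move=> k; rewrite -gi -fi.
- by move=> x; rewrite -fp -gp.
Qed.

Variables (K P R : groupType) (KNP : extension K P) (PQR : extension P R).
Implicit Types G : iterext KNP PQR.

Lemma iterext_iso_refl G : iterext_iso G G.
Proof.
exists (mk_ghom (f := fun g : G => g) (fun x y => erefl)); split=> //.
by exists (fun g => g).
Qed.

Lemma iterext_iso_sym G1 G2 : iterext_iso G1 G2 -> iterext_iso G2 G1.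
Proof.
case=> f [/ghom_inv[f' [fK f'K]] fi fp]; exists f'; split.
- by exists f.
- by move=> k; rewrite -fi fK.
- by move=> g; rewrite -fp f'K.
Qed.

Lemma iterext_iso_trans G1 G2 G3 :
  iterext_iso G1 G2 -> iterext_iso G2 G3 -> iterext_iso G1 G3.
Proof.
case=> f [fb fi fp] [g [gb gi gp]]; exists (ghom_comp g f); split.
- exact: bij_comp.
- by move=> k; rewrite -gi -fi.
- by move=> x; rewrite -fp -gp.
Qed.

Lemma main_ext_iso G1 G2 : iterext_iso G1 G2 -> ext_iso (main_ext G1) (main_ext G2).
Proof. by case=> f [fb fj fp]; exists f; split=> // k; apply: fj. Qed.
End IsoEquivalence.

Section ExtBoxTheory.
Variables (K Q : groupType) (theta : {ghom Q -> Out K}) (E : extension K Q).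
Hypothesis hE : has_outer_action E theta.
Local Notation i := (ext_inj E).
Local Notation pi := (ext_prj E).
Local Notation twK e := (ext_box_twist hE e).

Lemma ext_box_outer e : has_outer_action (ext_box hE e) theta.
Proof.
move=> g; have [a aE ag] := hE g; exists a => // k.
apply: (@mulIg (ext_box hE e) g); rewrite mulgVK.
rewrite [LHS](ext_box_mull hE) [RHS](ext_box_mulr hE).
by rewrite aE mulgVK.
Qed.

Definition ext_shift (z : Q -> ZK theta) (g : E) : E := i (sg_val (z (pi g))) * g.

Lemma ext_shift_prj z g : pi (ext_shift z g) = pi g.
Proof. by rewrite gmulfM ext_prj_inj mul1g. Qed.

Lemma ext_shift_bij z : bijective (ext_shift z).
Proof.
exists (fun g => (i (sg_val (z (pi g))))^-1 * g) => g.
  by rewrite ext_shift_prj mulKg.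
by rewrite /ext_shift gmulfM gmulfV ext_prj_inj invg1 mul1g mulVKg.
Qed.

Lemma ext_shift_mul (e e' : sg_type (Z2 (ZK theta))) z (g h : E) :
  sg_val e (pi g) (pi h) * z (pi g * pi h) =
  sg_val e' (pi g) (pi h) * (z (pi g) * gact (pi g) (z (pi h))) ->
  ext_shift z ((g : twisted (twK e)) * (h : twisted (twK e))) =
  (ext_shift z g : twisted (twK e')) * (ext_shift z h : twisted (twK e')).
Proof.
move=> ez; rewrite !twistedE /ext_box_fun !ext_shift_prj /ext_shift.
rewrite !gmulfM ext_prj_inj mul1g !mulgA.
rewrite -(gmulfM (s := i)) -centerC -sg_valM ez !sg_valM !gmulfM !mulgA.
congr (_ * _); rewrite -!mulgA; congr (_ * (_ * _)).
by rewrite ext_inj_act // mulgVK.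
Qed.

End ExtBoxTheory.

Lemma gm_divP (Q : groupType) (A : gmodule Q) (a b c f : A) :
  a / b = c / f -> a * f = b * c.
Proof.
move=> ab; rewrite -(mulgVK b a) ab -mulgA (gm_mulC b f) mulgA mulgVK.
exact: gm_mulC.
Qed.

Lemma ext_box_iso (K Q : groupType) (theta : {ghom Q -> Out K})
    (E : extension K Q) (hE : has_outer_action E theta) e e' :
  qcls (B2 (ZK theta)) e = qcls (B2 (ZK theta)) e' ->
  ext_iso (ext_box hE e) (ext_box hE e').
Proof.
move=> /H2_eqP[z z1 zE].
have fM : {morph (@ext_shift _ _ theta E z : ext_box hE e -> ext_box hE e')
             : x y / x * y}.
  move=> x y; refine (@ext_shift_mul _ _ _ _ hE e e' z x y _); apply: gm_divP.
  by rewrite -zE sg_valM sg_valV.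
exists (mk_ghom fM); split.
- exact (@ext_shift_bij _ _ theta E z).
- by move=> k /=; rewrite /ext_shift ext_prj_inj z1 sg_val1 gmulf1 mul1g.
- exact (@ext_shift_prj _ _ theta E z).
Qed.

Section IterBox.
Variables (K P R : groupType) (PQR : extension P R) (theta : {ghom PQR -> Out K}).
Variables (KNP : extension K P) (G : iterext KNP PQR).
Hypothesis hG : has_outer_action (main_ext G) theta.

Definition ZKP : gmodule R := fixed_module (ZK theta).

(* The factor d(phi(g1), phi(g2)) of the product of d [x] G, as an element of G. *)
Definition iter_box_fun (d : sg_type (Z2 ZKP)) (g1 g2 : G) : G :=
  ie_j G (ext_inj KNP (sg_val (sg_val
    (sg_val d (ext_prj PQR (ie_pi G g1)) (ext_prj PQR (ie_pi G g2)))))).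

Fact iter_box_twist d : is_twist (iter_box_fun d).
Proof. exact: (ext_box_twist hG (Z2_infl (ZK theta) d)). Qed.

Fact iter_box_injM d :
  {morph (ie_j G : KNP -> twisted (iter_box_twist d)) : x y / x * y}.
Proof.
move=> x y; rewrite twistedE /iter_box_fun !ie_comm !ext_prj_inj.
have /asboolP[-> _ _] := sg_valP d.
by rewrite !(sg_val1, gmulf1) mul1g; exact (@gmulfM _ _ (ie_j G) x y).
Qed.

Fact iter_box_prjM d :
  {morph (ie_pi G : twisted (iter_box_twist d) -> PQR) : x y / x * y}.
Proof.
by move=> x y; rewrite twistedE !gmulfM ie_comm ext_prj_inj gmulf1 mul1g.
Qed.

Definition iter_box (d : sg_type (Z2 ZKP)) : iterext KNP PQR :=
  @IterExt K P R KNP PQR (twisted (iter_box_twist d))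
    (mk_ghom (@iter_box_injM d)) (mk_ghom (@iter_box_prjM d))
    (@ie_jI _ _ _ _ _ G) (@ie_piS _ _ _ _ _ G) (@ie_comm _ _ _ _ _ G)
    (@ie_ker_phi _ _ _ _ _ G) (@ie_ker_pi _ _ _ _ _ G).

Lemma iter_box_mull d (g : G) n :
  (ie_j G n : twisted (iter_box_twist d)) * (g : twisted (iter_box_twist d))
  = ie_j G n * g :> G.
Proof.
rewrite twistedE /iter_box_fun ie_comm ext_prj_inj.
by have /asboolP[-> _ _] := sg_valP d; rewrite !(sg_val1, gmulf1) mul1g.
Qed.

Lemma iter_box_mulr d (g : G) n :
  (g : twisted (iter_box_twist d)) * (ie_j G n : twisted (iter_box_twist d))
  = g * ie_j G n :> G.
Proof.
rewrite twistedE /iter_box_fun ie_comm ext_prj_inj.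
by have /asboolP[_ -> _] := sg_valP d; rewrite !(sg_val1, gmulf1) mul1g.
Qed.

Lemma iter_box_modK d Theta : has_modK_action G Theta -> has_modK_action (iter_box d) Theta.
Proof.
move=> hT g; have [a aE ag] := hT g; exists a => // n.
apply: (@mulIg (iter_box d) g); rewrite mulgVK.
rewrite [LHS](iter_box_mull d) [RHS](iter_box_mulr d).
by rewrite aE mulgVK.
Qed.

Lemma iter_box_iso d d' : qcls (B2 ZKP) d = qcls (B2 ZKP) d' ->
  iterext_iso (iter_box d) (iter_box d').
Proof.
move=> /H2_eqP[z z1 zE].
pose zQ (q : PQR) : ZK theta := sg_val (z (ext_prj PQR q)).
pose f : G -> G := ext_shift (E := main_ext G) (theta := theta) zQ.
have fM : {morph (f : iter_box d -> iter_box d') : x y / x * y}.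
  move=> x y.
  apply: (@ext_shift_mul _ _ _ _ hG (Z2_infl (ZK theta) d)
            (Z2_infl (ZK theta) d') zQ x y).
  have := gm_divP (etrans (esym _) (zE (ext_prj PQR (ie_pi G x)) (ext_prj PQR (ie_pi G y)))).
  rewrite sg_valM sg_valV => /(_ _ _ erefl) /(congr1 (@sg_val _ _)).
  rewrite !sg_valM /zQ gmulfM (fixed_actE _ (erefl _)) => H; exact: H.
exists (mk_ghom fM); split.
- exact (@ext_shift_bij _ _ theta (main_ext G) zQ).
- move=> n; rewrite /= /f /ext_shift /zQ /= ie_comm ext_prj_inj z1.
  by rewrite !(sg_val1, gmulf1) mul1g.
- exact (@ext_shift_prj _ _ theta (main_ext G) zQ).
Qed.

(* The class [d] with G' isomorphic to iter_box d. It exists and is unique when G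
   and G' have the same mod-K outer action; the default value 1 of xget is then
   irrelevant. *)
Definition iter_ratio (G' : iterext KNP PQR) : H2 ZKP :=
  xget 1 [set c | exists2 d, c = qcls (B2 ZKP) d & iterext_iso G' (iter_box d)].
End IterBox.
Lemma ext_box_subext (K P R : groupType) (PQR : extension P R)
    (theta : {ghom PQR -> Out K}) (E : extension K PQR)
    (hE : has_outer_action E theta) e :
  qcls (B2 (ZK theta)) e \in (H2P (ZK theta) : {pred _}) ->
  ext_iso (subext (ext_box hE e)) (subext E).
Proof.
move=> /eqP; rewrite H2_resE -qcls1 => /H2_eqP[z z1 zE].
pose zK (p : P) : ZK theta := z p.
have ez p q : sg_val (zK (p * q)) *
    sg_val (sg_val e (ext_inj PQR p) (ext_inj PQR q)) =
    sg_val (zK p) * sg_val (gact (ext_inj PQR p) (zK q)).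
  have := zE p q; rewrite invg1 mulg1 [X in X = _]Z2_pull_funE => eE.
  have {}eE := congr1 (fun x => x * z (p * q)) eE.
  rewrite mulgVK gm_mulC in eE; have := congr1 (@sg_val _ _) eE.
  by rewrite -[RHS]sg_valM -[LHS]sg_valM; apply.
pose i := ext_inj E.
pose prj := subext_prj_fun (E := ext_box hE e).
have fP (x : sg_type (preimP (ext_box hE e))) :
    i (sg_val (zK (prj x))) * (sg_val x : E) \in (preimP E : {pred E}).
  apply/asboolP; have /asboolP[p xp] := sg_valP x; exists p.
  by rewrite gmulfM ext_prj_inj mul1g.
pose f x : sg_type (preimP E) := SgElt (fP x).
have prjE x : ext_inj PQR (prj x) = ext_prj E (sg_val x).
  exact: (subext_prj_funE x).
have fM : {morph f : x y / x * y}.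
  move=> x y; apply: sg_inj; rewrite [RHS]sg_valM.
  have xyE : sg_val (x * y) = i (sg_val (sg_val e (ext_inj PQR (prj x))
      (ext_inj PQR (prj y)))) * ((sg_val x : E) * (sg_val y : E)) :> E.
    by rewrite !prjE; exact: (sg_valM x y).
  have pxy : prj (x * y) = prj x * prj y by exact: subext_prjM.
  apply: (etrans (congr2 (fun a b : E => a * b)
    (congr1 (fun p => i (sg_val (zK p))) pxy) xyE)).
  rewrite mulgA -gmulfM ez gmulfM prjE (ext_inj_act hE).
  by rewrite !mulgA mulgVK.
have fK x : (i (sg_val (zK (subext_prj_fun x))))^-1 * sg_val x \in
    (preimP (ext_box hE e) : {pred _}).
  apply/asboolP; have /asboolP[p xp] := sg_valP x; exists p.
  by rewrite /= gmulfM gmulfV ext_prj_inj invg1 mul1g.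
have pf x : subext_prj_fun (f x) = prj x.
  apply: (@ext_injI _ _ PQR); rewrite subext_prj_funE prjE /=.
  by rewrite gmulfM ext_prj_inj mul1g.
pose g x : sg_type (preimP (ext_box hE e)) := SgElt (fK x).
have pg x : prj (g x) = subext_prj_fun x.
  apply: (@ext_injI _ _ PQR); rewrite subext_prj_funE prjE /=.
  by rewrite gmulfM gmulfV ext_prj_inj invg1 mul1g.
exists (mk_ghom fM); split.
- exists g => x; apply: sg_inj; rewrite /=.
    by rewrite pf; exact: (@mulKg E).
  by rewrite pg; exact: (@mulVKg E).
- move=> k; apply: sg_inj; rewrite /=.
  have -> : prj (subext_inj_fun (ext_box hE e) k) = 1.
    apply: (@ext_injI _ _ PQR); rewrite prjE gmulf1; exact: ext_prj_inj.
  by rewrite /zK z1 (sg_val1 (center K)) gmulf1 mul1g.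
- exact: pf.
Qed.

Section MainExt.
Variables (K P R : groupType) (KNP : extension K P) (PQR : extension P R).
Implicit Types G : iterext KNP PQR.

Lemma main_ext_outer (theta : {ghom PQR -> Out K}) (Theta : {ghom PQR -> OutK KNP})
    G G' :
  has_outer_action (main_ext G) theta -> has_modK_action G Theta ->
  has_modK_action G' Theta -> has_outer_action (main_ext G') theta.
Proof.
move=> hG hT hT' g'; have [g gg'] := ie_piS G (ie_pi G' g').
have [a aE ag] := hT g; have [a' aE' ag'] := hT' g'; have [b bE bg] := hG g.
have /qclsP/asboolP[k kE] : qcls (InnK KNP) a' = qcls (InnK KNP) a.
  by rewrite -ag -ag' gg'.
exists (inn k * b); last first.
  rewrite -[ext_prj _ g']gg' [LHS]bg qclsM.
  have -> : qcls (Inn K) (inn k) = 1.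
    rewrite -qcls1; apply/qclsP; rewrite divg1; apply/asboolP; by exists k.
  by rewrite mul1g.
move=> x; rewrite [RHS](esym (aE' (ext_inj KNP x))).
congr (ie_j G' _).
have -> : sg_val a' = inn (ext_inj KNP k) * sg_val a.
  by rewrite -kE sg_valM sg_valV mulgVK.
rewrite !aut_mulE !innE !gmulfM gmulfV; congr (_ * _ * _).
by apply: (@ie_jI _ _ _ _ _ G); rewrite aE; apply: bE.
Qed.

Lemma main_ext_subext G : ext_iso (subext (main_ext G)) KNP.
Proof.
apply: ext_iso_sym.
have jP n : ie_j G n \in (preimP (main_ext G) : {pred _}).
  by apply/asboolP; exists (ext_prj KNP n); apply: ie_comm.
pose f n : sg_type (preimP (main_ext G)) := SgElt (jP n).
have fM : {morph f : x y / x * y}.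
  by move=> x y; apply: sg_inj; rewrite [RHS]sg_valM; apply: (@gmulfM _ _ (ie_j G)).
have fI : injective f by move=> x y /(congr1 (@sg_val _ _))/ie_jI.
have fS y : exists x, f x = y.
  have /asboolP[p yp] := sg_valP y.
  have [n yn] : exists n, sg_val y = ie_j G n.
    by apply/ie_ker_phi; rewrite [ie_pi _ _]yp ext_prj_inj.
  by exists n; apply: sg_inj; rewrite yn.
exists (mk_ghom fM); split.
- exists (fun y => sval (cid (fS y))) => x; last exact: svalP (cid (fS x)).
  by apply: fI; exact: svalP (cid (fS (f x))).
- by move=> k; apply: sg_inj.
- move=> n; apply: (@ext_injI _ _ PQR); rewrite [LHS]subext_prj_funE.
  exact: ie_comm.
Qed.
End MainExt.

(* Isomorphism classes are predicates rather than elements of an {eq_quot} type: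
   universe levels rule out a choiceType structure on a type of extensions. *)
Section IsoClasses.
Variables (T : Type) (r : T -> T -> Prop).
Definition iso_classes := {C : T -> Prop | exists x, C = r x}.
Definition iso_class (x : T) : iso_classes :=
  exist _ (r x) (ex_intro _ x erefl).

Hypothesis r_refl : forall x, r x x.
Hypothesis r_sym : forall x y, r x y -> r y x.
Hypothesis r_trans : forall x y z, r x y -> r y z -> r x z.

Lemma iso_classP x y : iso_class x = iso_class y <-> r x y.
Proof.
split=> [/(congr1 (@sval _ _))/(congr1 (fun C : T -> Prop => C y)) /= ->|rxy].
  exact: r_refl.
apply: eq_exist; apply/funext => z; apply/propext; split.
- exact: r_trans (r_sym rxy).
- exact: r_trans rxy.
Qed.

Definition iso_rep (C : iso_classes) : T := sval (cid (svalP C)).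
Lemma iso_repK C : iso_class (iso_rep C) = C.
Proof.
case: C => C CE; apply: eq_exist => /=.
by rewrite /iso_rep; case: cid => x /= ->.
Qed.
End IsoClasses.

Record ext_over (K P R : groupType) (PQR : extension P R) (KNP : extension K P)
    (theta : {ghom PQR -> Out K}) := ExtOver {
  eo_ext :> extension K PQR;
  eo_outer : has_outer_action eo_ext theta;
  eo_sub : ext_iso (subext eo_ext) KNP
}.
Arguments eo_outer {K P R PQR KNP theta} _ _.

Record iter_over (K P R : groupType) (PQR : extension P R) (KNP : extension K P)
    (Theta : {ghom PQR -> OutK KNP}) := IterOver {
  io_ext :> iterext KNP PQR;
  io_modK : has_modK_action io_ext Theta
}.
Arguments io_modK {K P R PQR KNP Theta} _ _.

Section Classes.
Variables (K P R : groupType) (PQR : extension P R) (KNP : extension K P).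
Variables (theta : {ghom PQR -> Out K}) (Theta : {ghom PQR -> OutK KNP}).
Local Notation ext_over := (ext_over KNP theta).
Local Notation iter_over := (iter_over Theta).

Definition ext_over_classes := iso_classes (fun E1 E2 : ext_over => ext_iso E1 E2).
Definition iter_over_classes :=
  iso_classes (fun G1 G2 : iter_over => iterext_iso G1 G2).

Definition ext_over_class (E : ext_over) : ext_over_classes := iso_class _ E.
Definition iter_over_class (G : iter_over) : iter_over_classes := iso_class _ G.

Lemma ext_over_classP E1 E2 :
  ext_over_class E1 = ext_over_class E2 <-> ext_iso E1 E2.
Proof.
apply: (@iso_classP _ (fun E1 E2 : ext_over => ext_iso E1 E2)) => *.
- exact: ext_iso_refl.
- exact: ext_iso_sym.
- by apply: ext_iso_trans; eassumption.
Qed.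

Lemma iter_over_classP G1 G2 :
  iter_over_class G1 = iter_over_class G2 <-> iterext_iso G1 G2.
Proof.
apply: (@iso_classP _ (fun G1 G2 : iter_over => iterext_iso G1 G2)) => *.
- exact: iterext_iso_refl.
- exact: iterext_iso_sym.
- by apply: iterext_iso_trans; eassumption.
Qed.

Section Boxtimes.
Variables (E : ext_over).

Fact ext_over_box_sub e :
  qcls (B2 (ZK theta)) e \in (H2P (ZK theta) : {pred _}) ->
  ext_iso (subext (ext_box (eo_outer E) e)) KNP.
Proof. by move=> eP; apply: ext_iso_trans (ext_box_subext _ eP) (eo_sub E). Qed.

Definition ext_over_box e (eP : qcls (B2 (ZK theta)) e \in (H2P (ZK theta) : {pred _})) :
  ext_over := ExtOver (@ext_box_outer _ _ _ _ (eo_outer E) e) (ext_over_box_sub eP).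

Fact ext_boxtimes_subproof (c : sg_type (H2P (ZK theta))) :
  qcls (B2 (ZK theta)) (repr (sg_val c)) \in (H2P (ZK theta) : {pred _}).
Proof. by rewrite qcls_repr; apply: sg_valP. Qed.

(* [e] |-> class of e [x] E; ext_boxtimesE shows that the choice of the
   representative e does not matter. *)
Definition ext_boxtimes (c : sg_type (H2P (ZK theta))) : ext_over_classes :=
  ext_over_class (ext_over_box (ext_boxtimes_subproof c)).

Lemma ext_boxtimesE e eP :
  ext_boxtimes (@SgElt _ (H2P (ZK theta)) (qcls (B2 (ZK theta)) e) eP) =
  ext_over_class (ext_over_box eP).
Proof. by apply/ext_over_classP; apply: ext_box_iso; rewrite qcls_repr. Qed.
End Boxtimes.

Section IterBoxtimes.
Variables (G : iterext KNP PQR) (hG : has_outer_action (main_ext G) theta).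
Variable hTheta : has_modK_action G Theta.

Definition iter_over_box d : iter_over :=
  IterOver (@iter_box_modK _ _ _ _ _ _ _ hG d _ hTheta).

(* [d] |-> class of d [x] G, with iter_boxtimesE. *)
Definition iter_boxtimes (c : H2 (ZKP theta)) : iter_over_classes :=
  iter_over_class (iter_over_box (repr c)).

Lemma iter_boxtimesE d :
  iter_boxtimes (qcls (B2 (ZKP theta)) d) = iter_over_class (iter_over_box d).
Proof. by apply/iter_over_classP; apply: iter_box_iso; rewrite qcls_repr. Qed.

Definition main_over (G' : iter_over) : ext_over :=
  ExtOver (@main_ext_outer _ _ _ _ _ _ _ G G' hG hTheta (io_modK G')) (main_ext_subext G').

(* Class of G' |-> class of the main extension of G', with main_classE. *)
Definition main_class (C : iter_over_classes) : ext_over_classes :=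
  ext_over_class (main_over (iso_rep C)).

Lemma main_classE G' : main_class (iter_over_class G') = ext_over_class (main_over G').
Proof.
apply/ext_over_classP; apply: main_ext_iso.
by apply/iter_over_classP; rewrite /iter_over_class iso_repK.
Qed.
End IterBoxtimes.
End Classes.

(* Main.v *)
Require Import Defs.
From mathcomp Require Import all_boot boolp classical_sets.

(** For a cocycle d of R with values in Z(K)^P, the main extension of d [x] G and
    the extension infl(d) [x] (main extension of G) have the same underlying set
    and the same product, since the factor d(phi(g1), phi(g2)) is the value of
    infl(d) at (pi(g1), pi(g2)); this is main_ext_iter_box. The equality of
    isomorphism classes follows at once, and so does the equality of ratios,
    provided that both ratios are well defined, which takes two facts.

    The ratio of extensions is unique (ext_box_iso_class): an isomorphism from
    e [x] E to e' [x] E multiplies each g by an element of K that is central and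
    depends only on pi(g), hence is a 1-cochain z : Q -> Z(K), and
    multiplicativity says that e and e' differ by the coboundary of z.

    The ratio of iterated extensions exists (biequivariant_iter_box). As G and G'
    induce the same mod-K outer action, each g in G has a companion g' in G' over
    the same element of Q that conjugates N in exactly the same way: correct any
    lift by an element of K. Choosing companions for one representative of each
    coset of N and extending by N-translation gives a map f : G -> G' over Q that
    commutes with the translations by N on both sides. Then f(g) f(h) and f(g h)
    lie over the same element of Q and conjugate N alike, so they differ by an
    element of K that centralizes N, that is, an element of Z(K)^P. Since f
    commutes with N-translations, this element depends only on phi(g) and phi(h);
    associativity in G' makes it a cocycle d, and f becomes an isomorphism from
    d [x] G to G'. *)

Set Implicit Arguments.
Unset Strict Implicit.
Unset Printing Implicit Defensive.

Local Open Scope group_scope.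

(** * The cohomology class of a twisted extension *)

Section ExtBoxClass.
Variables (K Q : groupType) (theta : {ghom Q -> Out K}) (E : extension K Q).
Hypothesis hE : has_outer_action E theta.
Local Notation i := (ext_inj E).
Local Notation pi := (ext_prj E).

Lemma ZK_valM (x y : ZK theta) : sg_val (x * y) = sg_val x * sg_val y.
Proof. exact: sg_valM. Qed.

Lemma ext_prj_fibre (g h : E) : pi g = pi h -> exists k, g = i k * h.
Proof.
move=> gh; have /ext_exact[k kE] : pi (g / h) = 1 by rewrite gmulfF gh divgg.
by exists k; rewrite -kE mulgVK.
Qed.

(** Converse of ext_box_iso: twists of E by cocycles of distinct classes are not
    isomorphic as extensions. *)
Lemma ext_box_iso_class e e' :
  ext_iso (ext_box hE e) (ext_box hE e') ->
  qcls (B2 (ZK theta)) e = qcls (B2 (ZK theta)) e'.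
Proof.
(* Seeing f as a map F of the set E allows computing with the product of E. *)
case=> f [_ fi fp]; pose F : E -> E := f.
have pF g : pi (F g) = pi g by exact: fp.
have F1 : F 1 = 1 by exact (gmulf1 (s := f)).
have Fl x g : F (i x * g) = i x * F g.
  have := @gmulfM _ _ f (i x) g; rewrite fi.
  by rewrite [X in f X](ext_box_mull hE) [RHS](ext_box_mull hE).
have Fr x g : F (g * i x) = F g * i x.
  have := @gmulfM _ _ f g (i x); rewrite fi.
  by rewrite [X in f X](ext_box_mulr hE) [RHS](ext_box_mulr hE).
have FM g h : F (i (sg_val (sg_val e (pi g) (pi h))) * (g * h)) =
              i (sg_val (sg_val e' (pi g) (pi h))) * (F g * F h).
  rewrite -[in RHS](pF g) -[in RHS](pF h); exact: (gmulfM (s := f)).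
have Fz g : exists z : ZK theta, F g = i (sg_val z) * g.
  have [k kE] := ext_prj_fibre (pF g).
  have kC : k \in (center K : {pred K}).
    (* F commutes with K-translations on both sides, so F g conjugates K as g does. *)
    apply/asboolP => x; apply: (@ext_injI _ _ E).
    have [y yE] : exists y, g * i y = i x * g.
      have /ext_exact[y yE] : pi (g^-1 * i x * g) = 1.
        by rewrite !gmulfM gmulfV ext_prj_inj mulg1 mulVg.
      by exists y; rewrite -yE !mulgA mulgV mul1g.
    have := Fl x g; rewrite -yE Fr kE -mulgA yE !mulgA => kx.
    by rewrite !gmulfM; exact: mulIg kx.
  by exists (SgElt kC).
have /choice[z zE] : forall q, exists z : ZK theta,
    forall g, pi g = q -> F g = i (sg_val z) * g.
  move=> q; have [g0 <-] := ext_prjS E q; have [z zE] := Fz g0.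
  exists z => g /ext_prj_fibre[k ->].
  by rewrite Fl zE !mulgA -!gmulfM centerC.
apply/H2_eqP; exists z.
  apply: sg_inj; apply: (@ext_injI _ _ E); rewrite sg_val1 gmulf1.
  by have := zE _ 1 gmulf1; rewrite F1 mulg1.
move=> q r; have [g <-] := ext_prjS E q; have [h <-] := ext_prjS E r.
have key : sg_val e (pi g) (pi h) * z (pi g * pi h) =
           sg_val e' (pi g) (pi h) * (z (pi g) * gact (pi g) (z (pi h))).
  have := FM g h; rewrite (zE (pi g * pi h)); last first.
    by rewrite !gmulfM ext_prj_inj mul1g.
  rewrite (zE _ g erefl) (zE _ h erefl) mulgA -gmulfM centerC => zgh.
  apply: sg_inj; rewrite !ZK_valM.
  apply: (@ext_injI _ _ E); apply: (@mulIg E (g * h)); rewrite zgh.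
  by rewrite !gmulfM (ext_inj_act hE) !mulgA mulgVK.
rewrite sg_valM sg_valV !fun_mulE !fun_invE.
apply: (@mulIg _ (z (pi g * pi h))); rewrite mulgVK.
apply: (@mulIg _ (sg_val e' (pi g) (pi h))).
rewrite -!mulgA (gm_mulC (z _) (sg_val e' _ _)) (mulgA (_^-1)) mulVg mul1g key.
by rewrite gm_mulC mulgA.
Qed.

Lemma ext_ratioE (E' : extension K Q) e :
  ext_iso E' (ext_box hE e) -> ext_ratio hE E' = qcls (B2 (ZK theta)) e.
Proof.
move=> eE; rewrite /ext_ratio; apply: xget_unique => [|_ [e' -> e'E]].
  by exists e.
by apply: ext_box_iso_class; apply: ext_iso_trans (ext_iso_sym e'E) eE.
Qed.
End ExtBoxClass.

(** * Main extensions of twisted iterated extensions *)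

Section Infl.
Variables (K P R : groupType) (PQR : extension P R) (theta : {ghom PQR -> Out K}).
Variables (KNP : extension K P) (G : iterext KNP PQR).
Hypothesis hG : has_outer_action (main_ext G) theta.

(** The identity is the isomorphism: both sides are the set G, and their products
    unfold to the same expression. *)
Lemma main_ext_iter_box d :
  ext_iso (main_ext (iter_box hG d)) (ext_box hG (Z2_infl (ZK theta) d)).
Proof.
exists (mk_ghom (G := main_ext (iter_box hG d))
  (H := ext_box hG (Z2_infl (ZK theta) d)) (f := fun g => g) (fun x y => erefl)).
by split=> //; exists (fun g => g).
Qed.

(** Any witness of the existence of a ratio makes iter_ratio, defined by choice,
    the class of some such witness. *)
Lemma iter_ratioP (G' : iterext KNP PQR) d : iterext_iso G' (iter_box hG d) ->
  exists2 d', iter_ratio hG G' = qcls (B2 (ZKP theta)) d'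
    & iterext_iso G' (iter_box hG d').
Proof.
move=> dG'; pose is_ratio : set (H2 (ZKP theta)) := fun c => exists2 d,
  c = qcls (B2 (ZKP theta)) d & iterext_iso G' (iter_box hG d).
by apply: (@xgetPex _ 1 is_ratio); exists (qcls _ d), d.
Qed.
End Infl.

(** * Comparison of iterated extensions with the same mod-K outer action *)

Section Biequivariant.
Variables (K P R : groupType) (PQR : extension P R) (KNP : extension K P).
Variables (G G' : iterext KNP PQR).
Local Notation phi g := (ext_prj PQR (ie_pi G g)).

Lemma ie_conj (H : iterext KNP PQR) (g : H) n :
  exists m, g * ie_j H n = ie_j H m * g.
Proof.
have /ie_ker_phi[m mE] : ext_prj PQR (ie_pi H (g * ie_j H n * g^-1)) = 1.
  by rewrite !gmulfM !gmulfV ie_comm ext_prj_inj mulg1 mulgV.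
by exists m; rewrite -mE mulgVK.
Qed.

Lemma ie_conjV (H : iterext KNP PQR) (g : H) m :
  exists n, g * ie_j H n = ie_j H m * g.
Proof.
have [n nE] := ie_conj g^-1 m; exists n.
by apply: (@mulgI _ g^-1); rewrite mulKg mulgA nE mulgVK.
Qed.

(** What remains of an isomorphism of iterated extensions when multiplicativity is
    only asked for products with a factor in N. *)
Record biequivariant (f : G -> G') : Prop := Biequivariant {
  be1 : f 1 = 1;
  be_pi : forall g, ie_pi G' (f g) = ie_pi G g;
  be_l : forall n g, f (ie_j G n * g) = ie_j G' n * f g;
  be_r : forall g n, f (g * ie_j G n) = f g * ie_j G' n
}.

Lemma biequivariant_bij f : biequivariant f -> bijective f.
Proof.
move=> bf.
have fI : injective f.
  move=> g h fgh.
  have /(@ext_prj_fibre _ _ (main_ext G))[k gE] : ie_pi G g = ie_pi G h.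
    by rewrite -!(be_pi bf) fgh.
  have : ie_j G' (ext_inj KNP k) * f h = 1 * f h.
    by rewrite -(be_l bf) mul1g -fgh gE.
  move=> /mulIg; rewrite -(gmulf1 (s := ie_j G')) => /ie_jI.
  by rewrite gE /= => ->; rewrite gmulf1 mul1g.
have fS y : exists g, f g = y.
  have [g gy] := ie_piS G (ie_pi G' y).
  have /(@ext_prj_fibre _ _ (main_ext G'))[k yE] : ie_pi G' y = ie_pi G' (f g).
    by rewrite (be_pi bf).
  by exists (ie_j G (ext_inj KNP k) * g); rewrite (be_l bf) yE.
have [f' f'K] := choice fS.
by exists f' => // g; apply: fI; rewrite f'K.
Qed.

(** The automorphisms of N given by g and by any lift x of pi(g) to G' have the
    same class mod K, so they differ by the inner automorphism of some k in K;
    dividing x by k makes them equal. *)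
Lemma modK_lift Theta (g : G) :
  has_modK_action G Theta -> has_modK_action G' Theta ->
  exists2 g' : G', ie_pi G' g' = ie_pi G g
    & forall n m, g * ie_j G n = ie_j G m * g ->
                  g' * ie_j G' n = ie_j G' m * g'.
Proof.
move=> hT hT'; have [x xg] := ie_piS G' (ie_pi G g).
have [a aE ag] := hT g; have [b bE bx] := hT' x.
have /qclsP/asboolP[k kE] : qcls (InnK KNP) b = qcls (InnK KNP) a.
  by rewrite -ag -bx xg.
have bk n : sg_val b n = ext_inj KNP k * sg_val a n * (ext_inj KNP k)^-1.
  have -> : sg_val b = inn (ext_inj KNP k) * sg_val a.
    by rewrite -kE sg_valM sg_valV mulgVK.
  by rewrite aut_mulE innE.
exists ((ie_j G' (ext_inj KNP k))^-1 * x).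
  by rewrite gmulfM gmulfV ie_comm ext_prj_inj gmulf1 invg1 mul1g.
move=> n m nm.
have -> : m = sg_val a n by apply: (@ie_jI _ _ _ _ _ G); rewrite aE nm mulgK.
have := bE n; rewrite bk !gmulfM gmulfV => bEn.
apply: (@mulIg _ x^-1); apply: (@mulgI _ (ie_j G' (ext_inj KNP k))).
by rewrite !mulgA mulgV mul1g mulgK -bEn.
Qed.

(** Every g is uniquely n u_r with r = phi(g), for chosen representatives u_r of
    the cosets of N, so f(n u_r) := n u'_r is left equivariant; it is right
    equivariant because u_r and its companion u'_r conjugate N alike. *)
Lemma biequivariant_exists Theta :
  has_modK_action G Theta -> has_modK_action G' Theta ->
  exists f, biequivariant f.
Proof.
move=> hT hT'.
have /choice[u uP] : forall r, exists u : G * G',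
    [/\ phi u.1 = r, ie_pi G' u.2 = ie_pi G u.1,
        forall n m, u.1 * ie_j G n = ie_j G m * u.1 ->
                    u.2 * ie_j G' n = ie_j G' m * u.2
      & r = 1 -> u = (1, 1)].
  (* The representative 1 of the coset N is what makes f 1 = 1. *)
  move=> r; have [->|r1] := EM (r = 1).
    exists (1, 1); split=> //=; rewrite ?gmulf1 //.
    by move=> n m; rewrite !mul1g !mulg1 => /ie_jI->.
  have [q qr] := ext_prjS PQR r; have [g gq] := ie_piS G q.
  have [g' g'g g'J] := modK_lift g hT hT'.
  by exists (g, g'); split=> //=; rewrite gq.
have /choice[nu nuE] : forall g, exists n, g = ie_j G n * (u (phi g)).1.
  move=> g; have [phi_u _ _ _] := uP (phi g).
  have /ie_ker_phi[n nE] : phi (g / (u (phi g)).1) = 1.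
    by rewrite !gmulfF phi_u divgg.
  by exists n; rewrite -nE mulgVK.
pose f g := ie_j G' (nu g) * (u (phi g)).2.
have fE n r : f (ie_j G n * (u r).1) = ie_j G' n * (u r).2.
  have phiE : phi (ie_j G n * (u r).1) = r.
    have [phi_u _ _ _] := uP r.
    by rewrite !gmulfM phi_u ie_comm ext_prj_inj mul1g.
  have := nuE (ie_j G n * (u r).1).
  by rewrite /f phiE => /mulIg/ie_jI <-.
exists f; split.
- have [_ _ _ /(_ erefl) u1] := uP 1.
  by have := fE 1 1; rewrite u1 /= !gmulf1 !mulg1.
- move=> g; rewrite [in RHS](nuE g) /f !gmulfM !ie_comm; congr (_ * _).
  by have [_ -> _ _] := uP (phi g).
- move=> n g; rewrite {1}(nuE g) mulgA -gmulfM fE gmulfM -mulgA.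
  by congr (_ * _).
- move=> g n; have [m mE] := ie_conj (u (phi g)).1 n.
  have [_ _ /(_ _ _ mE) mE' _] := uP (phi g).
  rewrite {1}(nuE g) -mulgA mE mulgA -gmulfM fE /f.
  by rewrite -[RHS]mulgA mE' gmulfM mulgA.
Qed.
End Biequivariant.

(** * The defect of multiplicativity is a cocycle *)

Section Defect.
Variables (K P R : groupType) (PQR : extension P R) (theta : {ghom PQR -> Out K}).
Variables (KNP : extension K P) (G G' : iterext KNP PQR).
Hypothesis hG : has_outer_action (main_ext G) theta.
Local Notation i0 := (ext_inj KNP).
Local Notation phi g := (ext_prj PQR (ie_pi G g)).
Local Notation zN z := (i0 (sg_val (sg_val z))).

Lemma ZKP_centralN (z : ZKP theta) (n : KNP) : zN z * n = n * zN z.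
Proof.
apply: (@ie_jI _ _ _ _ _ G); apply: (@mulIg _ (ie_j G n)^-1).
rewrite !gmulfM mulgK; have := ext_inj_act hG (ie_j G n) (sg_val z).
by rewrite [ext_prj _ _]ie_comm fixedP.
Qed.

(** The elements of K centralizing N are exactly those of Z(K)^P: they commute
    with K, and p acts on Z(K) as conjugation by any n above p. *)
Lemma centralN_ZKP k : (forall n : KNP, i0 k * n = n * i0 k) ->
  exists z : ZKP theta, sg_val (sg_val z) = k.
Proof.
move=> kn.
have kC : k \in (center K : {pred K}).
  by apply/asboolP => x; apply: (@ext_injI _ _ KNP); rewrite !gmulfM kn.
have kP : (SgElt kC : ZK theta) \in (fixed (ZK theta) : {pred _}).
  apply/asboolP => p; have [n <-] := ext_prjS KNP p; rewrite -(ie_comm G).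
  apply: (@sg_inj _ (center K)); apply: (@ext_injI _ _ (main_ext G)).
  rewrite [LHS](ext_inj_act hG) /=.
  by rewrite -(gmulfM (s := ie_j G)) -kn gmulfM mulgK.
by exists (SgElt kP).
Qed.

Lemma ZKP_conj g (z : ZKP theta) :
  g * ie_j G (zN z) = ie_j G (zN (gact (phi g) z)) * g.
Proof.
apply: (@mulIg _ g^-1); rewrite mulgK (fixed_actE z (erefl (phi g))).
exact: esym (ext_inj_act hG g (sg_val z)).
Qed.

Lemma zN_inj : injective (fun z : ZKP theta => ie_j G' (zN z)).
Proof.
move=> y z /ie_jI/ext_injI yz.
by apply: sg_inj; apply: (@sg_inj _ (center K)).
Qed.

Lemma zN_M (y z : ZKP theta) : zN (y * z) = zN y * zN z.
Proof. by rewrite -gmulfM. Qed.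

Variable f : G -> G'.
Hypothesis bf : biequivariant f.

(** By biequivariance f(g) f(h) and f(g h) both conjugate N as g h does, so their
    quotient, which lies in K, centralizes N. *)
Lemma defect_exists g h : exists z : ZKP theta,
  f g * f h = ie_j G' (zN z) * f (g * h).
Proof.
have /(@ext_prj_fibre _ _ (main_ext G'))[k kE] :
    ie_pi G' (f g * f h) = ie_pi G' (f (g * h)).
  by rewrite gmulfM !(be_pi bf) gmulfM.
have {}kE : f g * f h = ie_j G' (i0 k) * f (g * h) := kE.
suff /centralN_ZKP[z zk] : forall n : KNP, i0 k * n = n * i0 k.
  by exists z; rewrite zk.
move=> m; have [n nE] := ie_conjV g m; have [l lE] := ie_conjV h n.
have : f g * f h * ie_j G' l = ie_j G' m * (f g * f h).
  by rewrite -mulgA -(be_r bf) lE (be_l bf) mulgA -(be_r bf) nE (be_l bf) mulgA.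
rewrite kE -mulgA -(be_r bf) -mulgA lE mulgA nE -mulgA (be_l bf) !mulgA.
by move=> /mulIg; rewrite -!gmulfM => /ie_jI.
Qed.

(** With g m = l g, both sides pick up the factor n l on the left, and it
    commutes with z. *)
Lemma defect_trans (z : ZKP theta) n m g h :
  f g * f h = ie_j G' (zN z) * f (g * h) ->
  f (ie_j G n * g) * f (ie_j G m * h) =
  ie_j G' (zN z) * f (ie_j G n * g * (ie_j G m * h)).
Proof.
move=> zE; have [l lE] := ie_conj g m.
have -> : f (ie_j G n * g) * f (ie_j G m * h) =
          ie_j G' (n * l) * (f g * f h).
  rewrite !(be_l bf) gmulfM -!mulgA; congr (_ * _).
  by rewrite !mulgA -(be_l bf) -lE (be_r bf).
have -> : ie_j G n * g * (ie_j G m * h) = ie_j G (n * l) * (g * h).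
  by rewrite gmulfM mulgA -(mulgA _ g) lE !mulgA.
by rewrite (be_l bf) zE !mulgA -!gmulfM ZKP_centralN.
Qed.

Lemma defect_exists_R r s : exists z : ZKP theta, forall g h,
  phi g = r -> phi h = s -> f g * f h = ie_j G' (zN z) * f (g * h).
Proof.
have [q <-] := ext_prjS PQR r; have [g0 <-] := ie_piS G q.
have [q' <-] := ext_prjS PQR s; have [h0 <-] := ie_piS G q'.
have [z zE] := defect_exists g0 h0; exists z => g h gg hh.
have fibre x y : phi x = phi y -> exists n, x = ie_j G n * y.
  move=> xy; have /ie_ker_phi[n nE] : phi (x / y) = 1 by rewrite !gmulfF xy divgg.
  by exists n; rewrite -nE mulgVK.
have [n ->] := fibre _ _ gg; have [m ->] := fibre _ _ hh.
exact: defect_trans.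
Qed.

(** The cocycle identity compares the two bracketings of f(g) f(h) f(k); moving
    the defect of (h, k) to the left of f(g) produces the action of phi(g). *)
Lemma defect_cocycle : exists d : sg_type (Z2 (ZKP theta)), forall g h,
  f g * f h = ie_j G' (zN (sg_val d (phi g) (phi h))) * f (g * h).
Proof.
have [D DE] : exists D : R -> R -> ZKP theta, forall g h,
    f g * f h = ie_j G' (zN (D (phi g) (phi h))) * f (g * h).
  have [D DE] := choice (fun rs : R * R => defect_exists_R rs.1 rs.2).
  by exists (fun r s => D (r, s)) => g h; apply: DE.
have phiS r : exists g, phi g = r.
  by have [q <-] := ext_prjS PQR r; have [g <-] := ie_piS G q; exists g.
have D1 : ie_j G' (zN (1 : ZKP theta)) = 1 by rewrite !gmulf1.
have DP : D \in (Z2 (ZKP theta) : {pred _}).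
  apply/asboolP; split.
  - move=> r; have [g <-] := phiS r; apply: zN_inj; rewrite D1.
    have := DE 1 g; rewrite (be1 bf) !mul1g !gmulf1 -[LHS]mul1g.
    by move=> /mulIg.
  - move=> r; have [g <-] := phiS r; apply: zN_inj; rewrite D1.
    have := DE g 1; rewrite (be1 bf) !mulg1 !gmulf1 -[LHS]mul1g.
    by move=> /mulIg.
  - move=> r s t; have [g <-] := phiS r; have [h <-] := phiS s.
    have [k <-] := phiS t; apply: zN_inj; rewrite !zN_M !gmulfM.
    apply: (@mulIg _ (f (g * h * k))).
    have DEl := DE (g * h) k; have DEr := DE g (h * k).
    rewrite !gmulfM in DEl DEr; rewrite -[LHS]mulgA -[RHS]mulgA -DEl.
    rewrite -[g * h * k]mulgA -DEr mulgA -(DE g h) -mulgA (DE h k).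
    by rewrite !mulgA -(be_r bf) ZKP_conj (be_l bf).
by exists (SgElt DP).
Qed.

(** In d [x] G the product of x and y is d(phi(x), phi(y)) x y, and f maps it to
    d(phi(x), phi(y)) f(x y) = f(x) f(y). *)
Lemma biequivariant_iter_box : exists d, iterext_iso G' (iter_box hG d).
Proof.
have [d dE] := defect_cocycle; exists d; apply: iterext_iso_sym.
have fM : {morph (f : iter_box hG d -> G') : x y / x * y}.
  by move=> x y; rewrite dE -(be_l bf).
exists (mk_ghom fM); split.
- exact: biequivariant_bij bf.
- by move=> n; have := be_l bf n 1; rewrite (be1 bf) !mulg1.
- exact: be_pi bf.
Qed.
End Defect.

(** * Inflation and main extensions *)

Theorem proposition14p2 (K P R : groupType) (PQR : extension P R)
    (theta : {ghom PQR -> Out K}) (KNP : extension K P)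
    (G : iterext KNP PQR) (hG : has_outer_action (main_ext G) theta)
    (Theta : {ghom PQR -> OutK KNP}) (hTheta : has_modK_action G Theta) :
  (forall G' : iterext KNP PQR, has_modK_action G' Theta ->
     sg_val (infl (ZK theta) (iter_ratio hG G')) = ext_ratio hG (main_ext G'))
  /\
  (forall c : H2 (ZKP theta),
     main_class hG hTheta (iter_boxtimes hG hTheta c)
     = ext_boxtimes (main_over hG hTheta (IterOver hTheta)) (infl (ZK theta) c)).
Proof.
split.
- move=> G' hT'.
  have [f bf] := biequivariant_exists hTheta hT'.
  have [d dG'] := biequivariant_iter_box hG bf.
  have [d' -> G'd'] := iter_ratioP dG'.
  rewrite inflE; symmetry; apply: ext_ratioE.
  exact: ext_iso_trans (main_ext_iso G'd') (main_ext_iter_box hG d').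
- move=> c; have [d <-] := qcls_surj c.
  rewrite iter_boxtimesE main_classE; apply/ext_over_classP.
  apply: ext_iso_trans (main_ext_iter_box hG d) _.
  by apply: ext_box_iso; rewrite qcls_repr inflE.
Qed.
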